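(* Let $H$ be a closed normal subgroup of a Polish group $G$ and let $\pi\colon G\to G/H$ be the quotient map. Suppose there is an analytic transversal $T\subseteq G$ of $\pi$ for which the intersection $(T^{-2}T)\cap H$ is bounded in $G$. Then the section $\phi\colon G/H\to G$ for $\pi$ defined by $T$ is Borel measurable and modest with respect to the left coarse structures on $G/H$ and $G$. It follows that $$\mathcal E_q(G/H)=\mathcal E_L(G/H)=\mathcal E_{\rm Haus}(G/H).$$
   Context: A coarse structure on a set $X$ is an ideal $\mathcal E$ of subsets of $X\times X$ (closed under subsets and finite unions) containing the diagonal and closed under transposition $E\mapsto E^{\sf T}$ and composition $E\circ F=\{(x,z): \exists y\ (x,y)\in E,\ (y,z)\in F\}$. A pseudometric $d$ on $X$ induces the coarse structure $\mathcal E_d(X)=\{E\subseteq X\times X:\sup_{(x,y)\in E}d(x,y)<\infty\}$. A set $A\subseteq X$ is $\mathcal E$-bounded if $A\times A\in\mathcal E$. A map $\phi\colon(X,\mathcal E)\to(Y,\mathcal F)$ is controlled if $(\phi\times\phi)[E]\in\mathcal F$ for all $E\in\mathcal E$, and modest if $\phi[A]$ is $\mathcal F$-bounded for every $\mathcal E$-bounded $A\subseteq X$. For a topological group $G$, the left coarse structure is $\mathcal E_L(G)=\bigcap_d\mathcal E_d(G)$, where $d$ ranges over all continuous left-invariant pseudometrics on $G$. A subset of $G$ is called bounded if it is $\mathcal E_L(G)$-bounded. If $H$ is a closed normal subgroup, $\mathcal E_L(G/H)$ is the left coarse structure of the topological quotient group $G/H$; $\mathcal E_q(G/H)$ is the smallest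 coarse structure on $G/H$ making $\pi\colon (G,\mathcal E_L(G))\to G/H$ controlled; and $\mathcal E_{\rm Haus}(G/H)=\bigcap_d\mathcal E_{d_{\rm Haus}}(G/H)$, where $d$ ranges over the continuous left-invariant pseudometrics on $G$ and $d_{\rm Haus}$ is the Hausdorff distance between cosets with respect to $d$, which satisfies $d_{\rm Haus}(Hg,Hf)=\inf_{h\in H}d(hg,f)$. A transversal of $\pi$ is a set $T\subseteq G$ meeting every coset of $H$ in exactly one point; the section $\phi\colon G/H\to G$ defined by $T$ sends a coset $x$ to the unique element of $T\cap\pi^{-1}(x)$. Here $T^{-2}T=\{s^{-1}t^{-1}u: s,t,u\in T\}$. Analytic means a continuous image of a Polish space (or empty). *)

(* Defs.v *)
From HB Require Import structures.
From mathcomp Require Import all_boot all_order all_algebra.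
From mathcomp Require Import all_classical all_reals all_analysis.

Set Implicit Arguments.
Unset Strict Implicit.
Unset Printing Implicit Defensive.

Import Order.TTheory GRing.Theory Num.Theory.
Import numFieldNormedType.Exports.

Local Open Scope classical_set_scope.
Local Open Scope ring_scope.
Local Open Scope quotient_scope.

(* Multiplicative, possibly non-commutative, topological groups. No separation
   axiom is included. *)

HB.structure Definition PreTopologicalGroup := {G of Topological G & Group G}.

HB.mixin Record PreTopologicalGroup_isTopologicalGroup G
    & PreTopologicalGroup G := {
  mulg_continuous : continuous (fun xy : G * G => (xy.1 * xy.2)%g) ;
  invg_continuous : continuous (fun x : G => (x^-1)%g)
}.

#[short(type="topologicalGroupType")]
HB.structure Definition TopologicalGroup :=
  {G of PreTopologicalGroup G & PreTopologicalGroup_isTopologicalGroup G}.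

Record normal_subgroup (G : groupType) := NormalSubgroup {
  nsub_set :> set G ;
  nsub1 : nsub_set 1%g ;
  nsubM : forall x y, nsub_set x -> nsub_set y -> nsub_set (x * y)%g ;
  nsubV : forall x, nsub_set x -> nsub_set (x^-1)%g ;
  nsubJ : forall x g, nsub_set x -> nsub_set (x ^ g)%g
}.

Section coset_equivalence.
Variables (G : groupType) (H : normal_subgroup G).

Definition coset_rel (x y : G) : bool := `[< (H : set G) (x * y^-1)%g >].

Let coset_rel_refl : reflexive coset_rel.
Proof. by move=> x; apply/asboolP; rewrite mulgV; exact: nsub1. Qed.

Let coset_rel_sym : symmetric coset_rel.
Proof.
have sym x y : coset_rel x y -> coset_rel y x.
  by move=> /asboolP/nsubV; rewrite invgF => Hyx; exact/asboolP.
by move=> x y; apply/idP/idP; exact: sym.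
Qed.

Let coset_rel_trans : transitive coset_rel.
Proof.
move=> y x z /asboolP Hxy /asboolP Hyz; apply/asboolP.
by have := nsubM Hxy Hyz; rewrite mulgA mulgVK.
Qed.

Canonical coset_equiv :=
  EquivRel coset_rel coset_rel_refl coset_rel_sym coset_rel_trans.

End coset_equivalence.

Definition quotient_topgroup (G : topologicalGroupType) (H : normal_subgroup G) :=
  quotient_topology {eq_quot (coset_equiv H)}.

HB.instance Definition _ (G : topologicalGroupType) (H : normal_subgroup G) :=
  Topological.copy (quotient_topgroup H)
    (quotient_topology {eq_quot (coset_equiv H)}).
HB.instance Definition _ (G : topologicalGroupType) (H : normal_subgroup G) :=
  Quotient.copy (quotient_topgroup H)
    (quotient_topology {eq_quot (coset_equiv H)}).

Definition quotient_map (G : topologicalGroupType) (H : normal_subgroup G) :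
  G -> quotient_topgroup H := \pi_(quotient_topgroup H)%qT.

Section quotient_group_structure.
Variables (G : topologicalGroupType) (H : normal_subgroup G).
Local Notation Q := (quotient_topgroup H).
Local Notation pi := (quotient_map H).

Lemma quotient_mapP (x y : G) : pi x = pi y <-> (H : set G) (x * y^-1)%g.
Proof.
split => [xy|Hxy].
  have /eqmodP/asboolP// : x = y %[mod_eq coset_equiv H] by [].
have // : x = y %[mod_eq coset_equiv H] by exact/eqmodP/asboolP.
Qed.

Lemma quotient_map_repr (x : Q) : pi (repr x) = x.
Proof. exact: reprK. Qed.

Lemma quotient_map_surj (x : Q) : exists g, pi g = x.
Proof. by exists (repr x); exact: quotient_map_repr. Qed.

Definition quotient_one : Q := pi 1%g.
Definition quotient_inv (x : Q) : Q := pi (repr x)^-1%g.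
Definition quotient_mul (x y : Q) : Q := pi (repr x * repr y)%g.

Lemma quotient_mapM x y : quotient_mul (pi x) (pi y) = pi (x * y)%g.
Proof.
apply/quotient_mapP.
have /quotient_mapP Hx := quotient_map_repr (pi x).
have /quotient_mapP Hy := quotient_map_repr (pi y).
set x' := repr (pi x) in Hx *; set y' := repr (pi y) in Hy *.
have -> : (x' * y' * (x * y)^-1 = (x' * x^-1) * ((y' * y^-1) ^ x^-1))%g.
  by rewrite conjgE invgM invgK !mulgA mulgVK.
exact: (nsubM Hx (nsubJ _ Hy)).
Qed.

Lemma quotient_mapV x : quotient_inv (pi x) = pi (x^-1)%g.
Proof.
apply/quotient_mapP.
have /quotient_mapP/nsubV := quotient_map_repr (pi x).
rewrite invgF => /nsubJ-/(_ x).
by rewrite conjgE !mulgA mulVg mul1g invgK.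
Qed.

Let quotient_mulA : associative quotient_mul.
Proof.
move=> x y z; rewrite -(quotient_map_repr x) -(quotient_map_repr y).
by rewrite -(quotient_map_repr z) !quotient_mapM mulgA.
Qed.

Let quotient_mul1 : left_id quotient_one quotient_mul.
Proof.
by move=> x; rewrite -(quotient_map_repr x) quotient_mapM mul1g.
Qed.

Let quotient_1mul : right_id quotient_one quotient_mul.
Proof.
by move=> x; rewrite -(quotient_map_repr x) quotient_mapM mulg1.
Qed.

Let quotient_mulVx : left_inverse quotient_one quotient_inv quotient_mul.
Proof.
move=> x; rewrite -(quotient_map_repr x) quotient_mapV quotient_mapM.
by rewrite mulVg.
Qed.

Let quotient_mulxV : right_inverse quotient_one quotient_inv quotient_mul.
Proof.
move=> x; rewrite -(quotient_map_repr x) quotient_mapV quotient_mapM.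
by rewrite mulgV.
Qed.

HB.instance Definition _ := isGroup.Build (quotient_topgroup H)
  quotient_mulA quotient_mul1 quotient_1mul quotient_mulVx quotient_mulxV.

Lemma quotient_map_mul x y : pi (x * y)%g = (pi x * pi y)%g.
Proof. by rewrite -quotient_mapM. Qed.

Lemma quotient_map_inv x : pi (x^-1)%g = (pi x)^-1%g.
Proof. by rewrite -quotient_mapV. Qed.

Lemma quotient_map_continuous : continuous pi.
Proof. exact: pi_continuous. Qed.

Lemma quotient_openE (U : set Q) : open U = open (pi @^-1` U).
Proof. by []. Qed.

Lemma quotient_map_open (U : set G) : open U -> open (pi @` U).
Proof.
move=> oU; rewrite quotient_openE.
have -> : pi @^-1` (pi @` U) =
    \bigcup_(h in H) ((fun x => (h * x)%g) @^-1` U).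
  apply/seteqP; split => [x [u Uu /quotient_mapP uxH]|x [h Hh /= Uhx]].
    by exists (u * x^-1)%g => //=; rewrite mulgVK.
  by exists (h * x)%g => //; apply/quotient_mapP; rewrite mulgK.
apply: bigcup_open => h _; apply: open_comp => // x _.
have c : {for x, continuous (fun x : G => (h, x) : G * G)}.
  by apply: cvg_pair; [exact: cvg_cst|exact: cvg_id].
exact: (continuous_comp c (mulg_continuous (h, x))).
Qed.

Lemma quotient_map_nbhs (x : G) (U : set G) :
  nbhs x U -> nbhs (pi x) (pi @` U).
Proof.
rewrite nbhsE => -[V [oV Vx] VU]; rewrite nbhsE; exists (pi @` V).
  by split; [exact: quotient_map_open|exists x].
exact: image_subset.
Qed.

Let quotient_mul_continuous :
  continuous (fun xy : Q * Q => (xy.1 * xy.2)%g).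
Proof.
move=> -[x y] W /=.
rewrite -(quotient_map_repr x) -(quotient_map_repr y) -quotient_map_mul.
move: (repr x) (repr y) => a b /quotient_map_continuous.
move=> /(mulg_continuous (a, b))[[U V] /= [Ua Vb] UVW].
exists (pi @` U, pi @` V); first by split; exact: quotient_map_nbhs.
move=> [_ _] /= [[u Uu <-] [v Vv <-]].
by rewrite -quotient_map_mul; exact: (UVW (u, v)).
Qed.

Let quotient_inv_continuous : continuous (fun x : Q => (x^-1)%g).
Proof.
move=> x W /=; rewrite -(quotient_map_repr x) -quotient_map_inv.
move: (repr x) => a /quotient_map_continuous /(invg_continuous a) Ua.
apply: filterS (quotient_map_nbhs Ua) => _ [u Wu <-] /=.
by rewrite -quotient_map_inv.
Qed.

HB.instance Definition _ := PreTopologicalGroup_isTopologicalGroup.Build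
  (quotient_topgroup H) quotient_mul_continuous quotient_inv_continuous.

End quotient_group_structure.

Record coarse_structure (X : Type) (E : set (set (X * X))) : Prop := {
  coarse_sub : forall A B, A `<=` B -> E B -> E A ;
  coarse_setU : forall A B, E A -> E B -> E (A `|` B) ;
  coarse_diagonal : E diagonal ;
  coarse_inv : forall A, E A -> E (A^-1)%relation ;
  coarse_comp : forall A B, E A -> E B -> E (B \; A)%relation
}.

Definition coarse_bounded (X : Type) (E : set (set (X * X))) (A : set X) :=
  E (A `*` A).

Definition controlled (X Y : Type) (E : set (set (X * X)))
    (F : set (set (Y * Y))) (f : X -> Y) :=
  forall A, E A -> F [set (f xy.1, f xy.2) | xy in A].

Definition modest (X Y : Type) (E : set (set (X * X)))
    (F : set (set (Y * Y))) (f : X -> Y) :=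
  forall A, coarse_bounded E A -> coarse_bounded F (f @` A).

(* The distance takes values in the extended reals because it is applied both
   to finite pseudometrics and to Hausdorff distances. *)
Definition dist_coarse (R : realType) (X : Type) (d : X -> X -> \bar R) :
    set (set (X * X)) :=
  [set A | (ereal_sup [set d xy.1 xy.2 | xy in A] < +oo)%E].

Record pseudometric (R : realType) (X : Type) (d : X -> X -> R) : Prop := {
  pseudometric_refl : forall x, d x x = 0 ;
  pseudometric_sym : forall x y, d x y = d y x ;
  pseudometric_triangle : forall x y z, d x z <= d x y + d y z
}.

Lemma dist_coarse_structure (R : realType) (X : Type) (d : X -> X -> R) :
  pseudometric d -> coarse_structure (dist_coarse (fun x y => (d x y)%:E)).
Proof.
move=> [d0 dC dD].
have dP (A : set (X * X)) : dist_coarse (fun x y => (d x y)%:E) A <->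
    exists M : R, forall x y, A (x, y) -> d x y <= M.
  split => [supA|[M AM]]; last first.
    apply: (@le_lt_trans _ _ M%:E); last exact: ltry.
    by apply: ge_ereal_sup => _ [[x y] /AM dM <-]; rewrite lee_fin.
  exists (fine (ereal_sup [set (d xy.1 xy.2)%:E | xy in A])) => x y Axy.
  have sxy := @ereal_sup_ubound _ [set (d xy.1 xy.2)%:E | xy in A]
    (d x y)%:E (ex_intro2 _ _ (x, y) Axy erefl).
  rewrite -lee_fin fineK// fin_numE; apply/andP; split.
    by rewrite gt_eqF// (lt_le_trans _ sxy)// ltNyr.
  by rewrite lt_eqF.
split.
- by move=> A B AB /dP[M BM]; apply/dP; exists M => x y /AB/BM.
- move=> A B /dP[M AM] /dP[N BN]; apply/dP; exists (Num.max M N) => x y.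
  by rewrite le_max; case=> [/AM ->//|/BN ->]; rewrite orbT.
- by apply/dP; exists 0 => x y; rewrite /diagonal /= => ->; rewrite d0.
- by move=> A /dP[M AM]; apply/dP; exists M => x y /= /AM; rewrite dC.
- move=> A B /dP[M AM] /dP[N BN]; apply/dP; exists (M + N) => x z /= [y Axy Byz].
  by apply: (le_trans (dD x y z)); apply: lerD; [exact: AM|exact: BN].
Qed.

Lemma bigcap_coarse_structure (X I : Type) (D : set I)
    (E : I -> set (set (X * X))) :
  (forall i, D i -> coarse_structure (E i)) ->
  coarse_structure (\bigcap_(i in D) E i).
Proof.
move=> cE; split.
- move=> A B AB EB i Di; case: (cE i Di) => sE _ _ _ _.
  exact: sE AB (EB i Di).
- move=> A B EA EB i Di; case: (cE i Di) => _ uE _ _ _.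
  exact: uE (EA i Di) (EB i Di).
- by move=> i Di; case: (cE i Di).
- move=> A EA i Di; case: (cE i Di) => _ _ _ vE _.
  exact: vE (EA i Di).
- move=> A B EA EB i Di; case: (cE i Di) => _ _ _ _ oE.
  exact: oE (EA i Di) (EB i Di).
Qed.

Definition continuous_left_invariant_pseudometric (R : realType)
    (G : topologicalGroupType) : set (G -> G -> R) :=
  [set d | [/\ pseudometric d,
    forall g x y, d (g * x)%g (g * y)%g = d x y &
    continuous (fun xy : G * G => d xy.1 xy.2)]].
Arguments continuous_left_invariant_pseudometric : clear implicits.

Definition left_coarse (R : realType) (G : topologicalGroupType) :
    set (set (G * G)) :=
  \bigcap_(d in continuous_left_invariant_pseudometric R G)
    dist_coarse (fun x y => (d x y)%:E).
Arguments left_coarse : clear implicits.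

Lemma left_coarse_structure (R : realType) (G : topologicalGroupType) :
  coarse_structure (left_coarse R G).
Proof.
by apply: bigcap_coarse_structure => d [pd _ _]; exact: dist_coarse_structure.
Qed.

Definition hausdorff_distance (R : realType) (X : Type) (d : X -> X -> R)
    (A B : set X) : \bar R :=
  Order.max
    (ereal_sup [set ereal_inf [set (d a b)%:E | b in B] | a in A])
    (ereal_sup [set ereal_inf [set (d a b)%:E | a in A] | b in B]).

Section quotient_coarse_structures.
Variables (R : realType) (G : topologicalGroupType) (H : normal_subgroup G).

Definition quotient_coarse : set (set (quotient_topgroup H * quotient_topgroup H)) :=
  \bigcap_(F in [set F | coarse_structure F /\
                         controlled (left_coarse R G) F (quotient_map H)]) F.

Lemma quotient_coarse_structure : coarse_structure quotient_coarse.
Proof. by apply: bigcap_coarse_structure => F []. Qed.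

Lemma quotient_coarse_controlled :
  controlled (left_coarse R G) quotient_coarse (quotient_map H).
Proof. by move=> A EA F [_]; exact. Qed.

Lemma quotient_coarse_smallest (F : set (set _)) : coarse_structure F ->
  controlled (left_coarse R G) F (quotient_map H) -> quotient_coarse `<=` F.
Proof. by move=> cF piF A; apply. Qed.

Definition hausdorff_coarse : set (set (quotient_topgroup H * quotient_topgroup H)) :=
  \bigcap_(d in continuous_left_invariant_pseudometric R G)
    dist_coarse (fun x y : quotient_topgroup H => hausdorff_distance d
      (quotient_map H @^-1` [set x]) (quotient_map H @^-1` [set y])).

Lemma hausdorff_distance_coset (d : G -> G -> R) (g f : G) :
  continuous_left_invariant_pseudometric R G d ->
  hausdorff_distance d (quotient_map H @^-1` [set quotient_map H g])
    (quotient_map H @^-1` [set quotient_map H f]) =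
  ereal_inf [set (d (h * g)%g f)%:E | h in H].
Proof.
move=> [_ dl _].
have left_class a : quotient_map H a = quotient_map H g ->
    [set (d a b)%:E | b in quotient_map H @^-1` [set quotient_map H f]] =
    [set (d (h * g)%g f)%:E | h in H].
  move=> /quotient_mapP ag; apply/seteqP; split => [_ [b /= /quotient_mapP bf] <-|].
    exists ((b * f^-1)^-1 * (a * g^-1))%g; first exact: nsubM (nsubV bf) ag.
    by rewrite -[d (_ * g)%g f](dl (b * f^-1)%g) !mulgA mulgV mul1g !mulgVK.
  move=> _ [h Hh <-]; exists (a * g^-1 * h^-1 * f)%g.
    by apply/quotient_mapP; rewrite mulgK; exact: nsubM ag (nsubV Hh).
  by rewrite -[d (_ * g)%g f](dl (a * g^-1 * h^-1)%g) !mulgA !mulgVK.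
have right_class b : quotient_map H b = quotient_map H f ->
    [set (d a b)%:E | a in quotient_map H @^-1` [set quotient_map H g]] =
    [set (d (h * g)%g f)%:E | h in H].
  move=> /quotient_mapP bf; apply/seteqP; split => [_ [a /= /quotient_mapP ag] <-|].
    exists ((b * f^-1)^-1 * (a * g^-1))%g; first exact: nsubM (nsubV bf) ag.
    by rewrite -[d (_ * g)%g f](dl (b * f^-1)%g) !mulgA mulgV mul1g !mulgVK.
  move=> _ [h Hh <-]; exists (b * f^-1 * h * g)%g.
    by apply/quotient_mapP; rewrite mulgK; exact: nsubM bf Hh.
  by rewrite -[d (_ * g)%g f](dl (b * f^-1)%g) !mulgA !mulgVK.
rewrite /hausdorff_distance.
have sup_cst (A : set G) (F : G -> \bar R) c : A !=set0 ->
    (forall a, A a -> F a = c) -> ereal_sup [set F a | a in A] = c.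
  move=> [a0 Aa0] Fc; have -> : [set F a | a in A] = [set c].
    by apply/seteqP; split => [_ [a Aa <-]|_ ->]; [exact: Fc|exists a0; [|exact: Fc]].
  exact: ereal_sup1.
rewrite (sup_cst _ _ (ereal_inf [set (d (h * g)%g f)%:E | h in H])).
- rewrite (sup_cst _ _ (ereal_inf [set (d (h * g)%g f)%:E | h in H])).
  + by rewrite maxxx.
  + by exists f.
  + by move=> b /right_class ->.
- by exists g.
- by move=> a /left_class ->.
Qed.

End quotient_coarse_structures.
Arguments quotient_coarse R {G} H _.
Arguments hausdorff_coarse R {G} H _.

Definition metrizes (R : realType) (X : topologicalType) (d : X -> X -> R) :=
  [/\ pseudometric d, forall x y, d x y = 0 -> x = y &
    forall (x : X) (A : set X),
      nbhs x A <-> exists2 e : R, 0 < e & [set y | d x y < e] `<=` A].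

Definition complete_distance (R : realType) (X : topologicalType)
    (d : X -> X -> R) :=
  forall u : nat -> X,
    (forall e : R, 0 < e -> exists N, forall m n : nat,
       (N <= m)%N -> (N <= n)%N -> d (u m) (u n) < e) ->
    exists l : X, u @ \oo --> l.

Definition polish_space (R : realType) (X : topologicalType) :=
  (exists2 D : set X, countable D & dense D) /\
  (exists2 d : X -> X -> R, metrizes d & complete_distance d).
Arguments polish_space : clear implicits.

Definition analytic (R : realType) (X : topologicalType) (A : set X) :=
  A = set0 \/ exists (P : topologicalType) (f : P -> X),
    [/\ polish_space R P, continuous f & range f = A].
Arguments analytic R {X} A.

Definition borel_measurable (X Y : topologicalType) (f : X -> Y) :=
  forall B : set Y, <<s open >> B -> <<s open >> (f @^-1` B).

Section transversals.
Variables (G : topologicalGroupType) (H : normal_subgroup G).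

Definition coset_transversal (T : set G) :=
  forall x : quotient_topgroup H, exists! t, T t /\ quotient_map H t = x.

Definition section_of (T : set G) (x : quotient_topgroup H) : G :=
  xget 1%g [set t | T t /\ quotient_map H t = x].

End transversals.
Arguments coset_transversal {G} H T.
Arguments section_of {G} H T x.

(* T^{-2} T *)
Definition inv2_mul (G : groupType) (T : set G) : set G :=
  [set g | exists s t u, [/\ T s, T t, T u & g = (s^-1 * t^-1 * u)%g]].

(* Main.v *)
(* The section [phi] is Borel by Lusin separation: preimages of complementary
   open and closed sets are disjoint analytic sets covering [G/H].

   For a continuous left-invariant pseudometric [d] on [G], set
   [l x = d 1 (phi x)]. As [phi(y)^-1 phi(x)^-1 phi(xy)] lies in the bounded set
   [T^-2 T `&` H], [l] is subadditive and inversion-invariant up to a constant.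
   It is Borel, so by Baire category some [{l o pi <= n}] is non-meagre, and
   Pettis' lemma bounds [l] near [1]. A two-sided Birkhoff-Kakutani construction
   then gives a continuous left-invariant pseudometric on [G/H] whose balls have
   bounded [l], so [l] is bounded on bounded sets: [phi] is modest.

   If [E] is in the left coarse structure of [G/H], then
   [A = {x^-1 y | (x, y) in E}] is bounded, hence so is [phi(A)], and [E] is
   covered by the image under [pi] of the entourage [{(g, g a) | a in phi(A)}].
   This gives E_L <= E_q; E_q <= E_Haus <= E_L holds for every normal [H]. *)
Require Import Defs.
From mathcomp Require Import all_boot all_order all_algebra.
From mathcomp Require Import all_classical all_reals all_analysis.
From mathcomp Require Import ring lra.

Set Implicit Arguments.
Unset Strict Implicit.
Unset Printing Implicit Defensive.

Import Order.TTheory GRing.Theory Num.Theory.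
Import numFieldNormedType.Exports.

Local Open Scope classical_set_scope.
Local Open Scope ring_scope.

(** * Dependent choice and nested sets in complete metric spaces *)

Lemma invariant_dependent_choice (A : Type) (P : A -> Prop)
    (Q : nat -> A -> A -> Prop) (a0 : A) :
  P a0 -> (forall n a, P a -> exists2 b, P b & Q n a b) ->
  exists s : nat -> A,
    [/\ s 0%N = a0, forall n, P (s n) & forall n, Q n (s n) (s n.+1)].
Proof.
move=> Pa0 step.
have [f fP] : {f : nat * A -> A &
    forall p, P p.2 -> P (f p) /\ Q p.1 p.2 (f p)}.
  apply: (@choice _ _ (fun p b => P p.2 -> P b /\ Q p.1 p.2 b)) => -[n a] /=.
  have [/step-/(_ n)[b Pb Qb]|nPa] := pselect (P a); first by exists b.
  by exists a.
pose s := fix s n := if n is m.+1 then f (m, s m) else a0.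
have Ps n : P (s n) by elim: n => //= n IH; exact: (fP (n, s n) IH).1.
by exists s; split => // n; exact: (fP (n, s n) (Ps n)).2.
Qed.

Lemma decreasing_subset (X : Type) (A : nat -> set X) :
  (forall n, A n.+1 `<=` A n) -> forall m n, (m <= n)%N -> A n `<=` A m.
Proof.
move=> dec m; elim=> [|n IH]; first by rewrite leqn0 => /eqP->.
rewrite leq_eqVlt => /predU1P[->//|/IH mn].
exact: subset_trans (dec n) mn.
Qed.

Lemma pseudometric_ge0 (R : realType) (X : Type) (d : X -> X -> R) x y :
  pseudometric d -> 0 <= d x y.
Proof. by move=> [d0 dC dD]; have := dD x y x; rewrite d0 (dC y x); lra. Qed.

Lemma metrizes_nbhs_ball (R : realType) (X : topologicalType)
    (d : X -> X -> R) x e :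
  metrizes d -> 0 < e -> nbhs x [set y | d x y < e].
Proof. by move=> [_ _ dP] e0; apply/dP; exists e. Qed.

Lemma metrizes_open_ball (R : realType) (X : topologicalType)
    (d : X -> X -> R) x e :
  metrizes d -> open [set y | d x y < e].
Proof.
move=> [[d0 dC dD] _ dP]; rewrite openE => y /= xye; apply/dP.
exists (e - d x y); first by lra.
by move=> z /= yz; have := dD x y z; lra.
Qed.

(** [F n] collects the points at distance at least [n.+1%:R^-1] from every point of the complement
    of [U]. *)
Lemma metrizes_open_Fsigma (R : realType) (X : topologicalType)
    (d : X -> X -> R) (U : set X) :
  metrizes d -> open U ->
  exists2 F : nat -> set X, forall n, closed (F n) & U = \bigcup_n F n.
Proof.
move=> md oU; have [[d0 dC dD] _ dP] := md.
exists (fun n => ~` (\bigcup_(c in ~` U) [set y | d c y < n.+1%:R^-1])).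
  move=> n; apply: open_closedC; apply: bigcup_open => c _.
  exact: metrizes_open_ball.
apply/seteqP; split => [x Ux|x [n _] nx].
  have /dP[e e0 eU] : nbhs x U by exact: open_nbhs_nbhs.
  have [n _ /(_ n (leqnn n))] := near_infty_natSinv_lt (PosNum e0).
  rewrite /= => ne; exists n => // -[c Uc /= cx]; apply: Uc; apply: eU => /=.
  by rewrite dC; exact: lt_trans cx ne.
by apply: contrapT => Ux; apply: nx; exists x => //=; rewrite d0 invr_gt0.
Qed.

(** Any choice of points [u n] in [A n] is a Cauchy sequence. The sets are not assumed closed, so
    its limit [l] may lie outside all of them; what survives is that they shrink into every
    neighbourhood of [l]. *)
Lemma cantor_intersection (R : realType) (X : topologicalType)
    (d : X -> X -> R) (A : nat -> set X) :
  metrizes d -> complete_distance d ->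
  (forall n, A n !=set0) -> (forall n, A n.+1 `<=` A n) ->
  (forall n x y, A n.+1 x -> A n.+1 y -> d x y < n.+1%:R^-1) ->
  exists l : X, forall U : set X, nbhs l U -> exists n, A n `<=` U.
Proof.
move=> [[d0 dC dD] _ dP] cd /choice[u Au] decA dA.
have subA := decreasing_subset decA.
have small e : 0 < e -> exists N, forall x y, A N x -> A N y -> d x y < e.
  move=> e0; have [n _ /(_ n (leqnn n))] := near_infty_natSinv_lt (PosNum e0).
  move=> /= ne; exists n.+1 => x y Ax Ay.
  exact: lt_trans (dA n x y Ax Ay) ne.
have [|l ul] := cd u.
  move=> e /small[N AN]; exists N => m n Nm Nn.
  by apply: AN; [exact: subA Nm _ (Au m)|exact: subA Nn _ (Au n)].
exists l => U /dP[e e0 eU].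
have [N AN] : exists N, forall x y, A N x -> A N y -> d x y < e / 2.
  by apply: small; lra.
have : nbhs l [set y | d l y < e / 2] by apply/dP; exists (e / 2) => //; lra.
move=> /ul[M _ /= uM].
exists N => x ANx; apply: eU => /=.
pose m := maxn N M.
have lum : d l (u m) < e / 2 by apply: uM; exact: leq_maxr.
have umx : d (u m) x < e / 2.
  by apply: AN => //; apply: (subA N m) => //; exact: leq_maxl.
by have := dD l (u m) x; lra.
Qed.

(** * Baire category and the Baire property *)

(** Inside a given open set one chooses shrinking open sets, each with its closure in the previous
    one and in [O n]; the limit point lies in all these closures. *)
Lemma polish_dense_bigcap (R : realType) (X : topologicalType)
    (O : nat -> set X) :
  polish_space R X -> (forall n, open (O n) /\ dense (O n)) ->
  dense (\bigcap_n O n).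
Proof.
move=> [_ [d md cd]] Od W W0 oW; have [[d0 dC dD] _ dP] := md.
pose P (A : set X) := A !=set0 /\ open A.
pose Q n (A B : set X) := closure B `<=` A `&` O n /\
  forall x y, B x -> B y -> d x y < n.+1%:R^-1.
have step n A : P A -> exists2 B, P B & Q n A B.
  move=> [A0 oA]; have [x AOx] := (Od n).2 A A0 oA.
  have [e e0 eA] : exists2 e, 0 < e & [set y | d x y < e] `<=` A `&` O n.
    apply/dP; apply: open_nbhs_nbhs; split => //.
    by apply: openI => //; exact: (Od n).1.
  (* The first bound keeps the closure of the ball inside the ball of radius [e], the second makes
     its diameter small enough. *)
  pose r := Num.min (e / 2) (n.+1%:R^-1 / 2).
  have r0 : 0 < r by rewrite lt_min !divr_gt0// invr_gt0.
  have [re rn] : r <= e / 2 /\ r <= n.+1%:R^-1 / 2.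
    by split; rewrite ge_min lexx ?orbT.
  exists [set y | d x y < r].
    by split; [exists x => /=; rewrite d0|exact: metrizes_open_ball].
  split=> [y|y z /= xy xz]; last first.
    move: (n.+1%:R^-1) rn => c rn.
    by have := dD y x z; rewrite (dC y x); lra.
  move=> /(_ _ (metrizes_nbhs_ball y md r0))[z [/= xz yz]].
  by apply: eA => /=; have := dD x z y; rewrite (dC z y); lra.
have [A [A0 Ao AS]] := invariant_dependent_choice (conj W0 oW : P W) step.
have dec n : A n.+1 `<=` A n.
  by move=> x /subset_closure /((AS n).1 x)[].
have [l lA] := cantor_intersection md cd (fun n => (Ao n).1) dec
  (fun n => (AS n).2).
have subA := decreasing_subset dec.
have clA n : closure (A n) l.
  move=> U /lA[N AN].
  have [x Ax] := (Ao (maxn N n)).1.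
  by exists x; split; [apply: (subA n _ (leq_maxr N n))|
    apply: AN; apply: (subA N _ (leq_maxl N n))].
exists l; split => [|n _]; last by have /(AS n).1[] := clA n.+1.
by rewrite -A0; have /(AS 0%N).1[] := clA 1%N.
Qed.

Definition residual (X : topologicalType) (C : set X) :=
  exists2 O : nat -> set X, forall n, open (O n) /\ dense (O n) &
    \bigcap_n O n `<=` C.

Lemma residualW (X : topologicalType) (C D : set X) :
  C `<=` D -> residual C -> residual D.
Proof. by move=> CD [W Wd WC]; exists W => //; exact: subset_trans CD. Qed.

Lemma open_dense_residual (X : topologicalType) (C : set X) :
  open C -> dense C -> residual C.
Proof. by move=> oC dC; exists (fun=> C) => // x /(_ 0%N I). Qed.

Lemma residual_bigcap (X : topologicalType) (C : nat -> set X) :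
  (forall n, residual (C n)) -> residual (\bigcap_n C n).
Proof.
move=> rC; have /all_sig2[ O Od OC] := (fun n => cid2 (rC n)).
(* The double family is enumerated by pairs; a code of no pair gets the harmless dense open set
   [setT]. *)
exists (fun k => if unpickle k is Some (n, m) then O n m else setT).
  move=> k; case: unpickle => [[n m]|]; first exact: Od.
  by split=> [|W W0 _]; [exact: openT|rewrite setIT].
move=> x Ox n _; apply: (OC n) => m _.
by have := Ox (pickle (n, m)) I; rewrite pickleK.
Qed.

Lemma residualI (X : topologicalType) (C D : set X) :
  residual C -> residual D -> residual (C `&` D).
Proof.
move=> rC rD; have := @residual_bigcap _ (fun n => if n is 0%N then C else D).
move=> /(_ _)/residualW; apply; last by case.
by move=> x Cx; split; [exact: (Cx 0%N)|exact: (Cx 1%N)].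
Qed.

Lemma polish_residual_dense (R : realType) (X : topologicalType) (C : set X) :
  polish_space R X -> residual C -> dense C.
Proof.
move=> pX [ O Od OC] W W0 oW.
have [x [Wx Ox]] := polish_dense_bigcap pX Od W0 oW.
by exists x; split => //; exact: OC.
Qed.

Definition baire_property (X : topologicalType) (A : set X) :=
  exists2 U : set X, open U & residual [set x | A x <-> U x].

Lemma open_baire_property (X : topologicalType) (U : set X) :
  open U -> baire_property U.
Proof.
move=> oU; exists U => //; exists (fun=> setT) => //.
by move=> n; split=> [|W W0 _]; [exact: openT|rewrite setIT].
Qed.

(** The complement of [A] agrees generically with the exterior of [U]: only the boundary of [U] is
    lost, and the boundary of an open set is nowhere dense. *)
Lemma baire_propertyC (X : topologicalType) (A : set X) :
  baire_property A -> baire_property (~` A).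
Proof.
move=> [U oU rU]; exists (~` closure U).
  by apply: closed_openC; exact: closed_closure.
have oV : open (U `|` ~` closure U).
  by apply: openU => //; apply: closed_openC; exact: closed_closure.
have dV : dense (U `|` ~` closure U).
  move=> W [x Wx] oW; have [Ux|nUx] := pselect (closure U x).
    have [y [Uy Wy]] := Ux W (open_nbhs_nbhs (conj oW Wx)).
    by exists y; split => //; left.
  by exists x; split => //; right.
apply: residualW (residualI rU (open_dense_residual oV dV)) => x /= [AU VU].
split=> [nA|nU /AU Ux]; last by apply: nU; exact: subset_closure.
by case: VU => // /AU.
Qed.

Lemma baire_property_bigcup (X : topologicalType) (A : nat -> set X) :
  (forall n, baire_property (A n)) -> baire_property (\bigcup_n A n).
Proof.
move=> bA; have /all_sig2[U oU rU] := (fun n => cid2 (bA n)).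
exists (\bigcup_n U n).
  by apply: bigcup_open => n _; exact: oU.
apply: residualW (residual_bigcap rU) => x AU /=.
by split=> -[n _ /(AU n I) ?]; exists n.
Qed.

Lemma borel_baire_property (X : topologicalType) (A : set X) :
  <<s open >> A -> baire_property A.
Proof.
apply: smallest_sub => [|U]; last exact: open_baire_property.
split=> [|B|B]; last exact: baire_property_bigcup.
  exact/open_baire_property/open0.
by rewrite setTD; exact: baire_propertyC.
Qed.

(** * Borel separation of analytic sets *)

Definition borel_separated (X : topologicalType) (A B : set X) :=
  exists2 C : set X, <<s open >> C & A `<=` C /\ B `<=` ~` C.

Lemma borelC (X : topologicalType) (A : set X) :
  <<s open >> A -> <<s open >> (~` A).
Proof. by move=> ?; rewrite -setTD; apply: sigma_algebraCD. Qed.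

Lemma borel_separated_bigcup (X : topologicalType) (A B : nat -> set X) :
  (forall i j, borel_separated (A i) (B j)) ->
  borel_separated (\bigcup_i A i) (\bigcup_j B j).
Proof.
move=> AB; pose C i j := projT1 (cid2 (AB i j)).
have CP i j : [/\ <<s open >> (C i j), A i `<=` C i j & B j `<=` ~` C i j].
  by rewrite /C; case: cid2 => D oD [].
(* This is the union over [i] of the intersections over [j] of [C i j], written with complements to
   match the sigma-algebra operations. *)
exists (\bigcup_i ~` \bigcup_j ~` C i j).
  apply: sigma_algebra_bigcup => i; apply: borelC.
  apply: sigma_algebra_bigcup => j.
  by apply: borelC; case: (CP i j).
split=> [x [i _ Ax]|x [j _ Bx] [i _ nC]].
  by exists i => // -[j _]; apply; case: (CP i j) => _ + _; exact.
by apply: nC; exists j => //; case: (CP i j) => _ _; exact.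
Qed.

Lemma polish_dense_sequence (R : realType) (X : topologicalType)
    (d : X -> X -> R) (x0 : X) :
  metrizes d -> (exists2 D : set X, countable D & dense D) ->
  exists u : nat -> X, forall x r, 0 < r -> exists n, d (u n) x < r.
Proof.
move=> md [D cD dD]; have [[d0 dC _] _ _] := md.
have [D0|[u]] := pfcard_geP cD.
  have := dD setT (ex_intro _ x0 I) openT.
  by rewrite D0 setI0 => -[].
exists u => x r r0.
have [|y [/= xy Dy]] := dD [set y | d x y < r] _ (metrizes_open_ball x r md).
  by exists x; rewrite /= d0.
have su : set_surj setT D u by exact: surj.
have [n _ un] := su y Dy.
by exists n; rewrite un dC.
Qed.

Lemma hausdorff_open_separated (X : topologicalType) (x y : X) :
  hausdorff_space X -> x <> y ->
  exists U V : set X, [/\ open U, open V, U x, V y & U `<=` ~` V].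
Proof.
rewrite open_hausdorff => hX /eqP/hX[[U V] /= []].
rewrite !inE => Ux Vy [oU oV UV]; exists U, V; split => //.
by apply/disjoints_subset.
Qed.

(* Lusin's separation argument: a non-separable pair of images can be refined to
   a non-separable pair of images of smaller sets, and the limit points would
   then be separated by open sets. *)
Lemma lusin_separation (R : realType) (P X : topologicalType) (f : P -> X)
    (F1 F2 : set P) :
  polish_space R P -> hausdorff_space X -> continuous f ->
  closed F1 -> closed F2 ->
  (forall x y, F1 x -> F2 y -> f x <> f y) ->
  borel_separated (f @` F1) (f @` F2).
Proof.
move=> [sepP [d md cd]] hX cf cF1 cF2 F12; apply: contrapT => nsep.
have [[d0 dC dD] _ _] := md.
have sep0l (A : set X) : borel_separated set0 A.
  exists set0; first exact: sigma_algebra0.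
  by rewrite setC0; split; [exact: sub0set|exact: subsetT].
have sep0r (A : set X) : borel_separated A set0.
  exists setT; first by apply: sub_sigma_algebra; exact: openT.
  by split; [exact: subsetT|exact: sub0set].
have ne (A : set P * set P) : ~ borel_separated (f @` A.1) (f @` A.2) ->
    A.1 !=set0 /\ A.2 !=set0.
  move=> nA; split; apply/set0P/negP => /eqP A0; apply: nA; rewrite A0 image_set0.
    exact: sep0l.
  exact: sep0r.
have [[x0 _] _] := ne (F1, F2) nsep.
have [u ud] := polish_dense_sequence x0 md sepP.
pose small (n : nat) (A : set P) := forall x y, A x -> A y -> d x y < n.+1%:R^-1.
pose Q n (A B : set P * set P) :=
  [/\ B.1 `<=` A.1, B.2 `<=` A.2, small n B.1 & small n B.2].
have step n A : ~ borel_separated (f @` A.1) (f @` A.2) ->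
    exists2 B, ~ borel_separated (f @` B.1) (f @` B.2) & Q n A B.
  move=> nA; apply: contrapT => nB; apply: nA.
  (* Countably many small balls cut both sets into pieces. If every pair of pieces were separated,
     so would be the whole pair, by [borel_separated_bigcup]. *)
  pose b i := [set x | d (u i) x < n.+1%:R^-1 / 2].
  have cover (B : set P) : B = \bigcup_i (B `&` b i).
    apply/seteqP; split => [x Bx|x [i _ []]//].
    have [|i uix] := ud x (n.+1%:R^-1 / 2); first by rewrite divr_gt0// invr_gt0.
    by exists i.
  have small_b B i : small n (B `&` b i).
    rewrite /small /b => x y /= -[_ ux] [_ uy].
    move: (n.+1%:R^-1) ux uy => c ux uy.
    by have := dD x (u i) y; rewrite (dC x (u i)); lra.
  rewrite [A.1]cover [A.2]cover !image_bigcup.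
  apply: borel_separated_bigcup => i j; apply: contrapT => nij; apply: nB.
  exists (A.1 `&` b i, A.2 `&` b j) => //.
  by split; [exact: subIsetl|exact: subIsetl|exact: small_b|exact: small_b].
have [A [A0 nA /all_and4[dec1 dec2 sm1 sm2]]] := @invariant_dependent_choice _
  (fun A => ~ borel_separated (f @` A.1) (f @` A.2)) Q (F1, F2) nsep step.
have [l1 l1A] := cantor_intersection md cd (fun n => (ne _ (nA n)).1) dec1 sm1.
have [l2 l2A] := cantor_intersection md cd (fun n => (ne _ (nA n)).2) dec2 sm2.
have sub1 := decreasing_subset dec1.
have sub2 := decreasing_subset dec2.
(* Every neighbourhood of [l1] contains some nonempty [(A n).1], a subset of the closed set [F1]. *)
have F1l : F1 l1.
  apply: contrapT => nl; have /l1A[n An] : nbhs l1 (~` F1).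
    by apply: open_nbhs_nbhs; split; first exact: closed_openC.
  have [[x Ax] _] := ne _ (nA n).
  by apply: (An _ Ax); have := sub1 _ _ (leq0n n) _ Ax; rewrite A0.
have F2l : F2 l2.
  apply: contrapT => nl; have /l2A[n An] : nbhs l2 (~` F2).
    by apply: open_nbhs_nbhs; split; first exact: closed_openC.
  have [_ [x Ax]] := ne _ (nA n).
  by apply: (An _ Ax); have := sub2 _ _ (leq0n n) _ Ax; rewrite A0.
have [U [V [oU oV Ul Vl UV]]] := hausdorff_open_separated hX (F12 _ _ F1l F2l).
have /l1A[n nU] : nbhs l1 (f @^-1` U) by apply: cf; exact: open_nbhs_nbhs.
have /l2A[m mV] : nbhs l2 (f @^-1` V) by apply: cf; exact: open_nbhs_nbhs.
apply: (nA (maxn n m)); exists U; first exact: sub_sigma_algebra.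
split=> _ [x Ax <-].
  by apply: nU; exact: sub1 (leq_maxl n m) _ Ax.
by move=> /UV; apply; apply: mV; exact: sub2 (leq_maxr n m) _ Ax.
Qed.

(** * Translations and Pettis' lemma *)

Lemma mulgl_continuous (G : topologicalGroupType) (g : G) :
  continuous (fun x => g * x)%g.
Proof.
move=> x; have c : {for x, continuous (fun x : G => (g, x) : G * G)}.
  by apply: cvg_pair; [exact: cvg_cst|exact: cvg_id].
exact: (continuous_comp c (mulg_continuous (g, x))).
Qed.

Lemma mulgr_continuous (G : topologicalGroupType) (g : G) :
  continuous (fun x => x * g)%g.
Proof.
move=> x; have c : {for x, continuous (fun x : G => (x, g) : G * G)}.
  by apply: cvg_pair; [exact: cvg_id|exact: cvg_cst].
exact: (continuous_comp c (mulg_continuous (x, g))).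
Qed.

Lemma dense_mulgl (G : topologicalGroupType) (g : G) (A : set G) :
  dense A -> dense [set x | A (g * x)%g].
Proof.
move=> dA W [x Wx] oW.
have [||y [Wy Ay]] := dA [set y | W (g^-1 * y)%g].
- by exists (g * x)%g; rewrite /= mulKg.
- by apply: open_comp => // y _; exact: mulgl_continuous.
by exists (g^-1 * y)%g; split => //=; rewrite mulVKg.
Qed.

Lemma residual_mulgl (G : topologicalGroupType) (g : G) (A : set G) :
  residual A -> residual [set x | A (g * x)%g].
Proof.
move=> [ O Od OA]; exists (fun n => [set x | O n (g * x)%g]).
  move=> n; have [oO dO] := Od n; split; last exact: dense_mulgl.
  by apply: open_comp => // x _; exact: mulgl_continuous.
by move=> x Ox; apply: OA => n _; exact: Ox.
Qed.

(** A generic [x] lies in some [A n] and hence in its open approximation [U n]. For [g] near [1],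
    the open set of [y] with [y] and [g^-1 * y] both in [U n] contains [g * x], so some generic [y]
    in it has both points in [A n]; their quotient is [g]. *)
Lemma pettis_cover (R : realType) (G : topologicalGroupType)
    (A : nat -> set G) :
  polish_space R G -> (forall n, baire_property (A n)) ->
  (forall x, exists n, A n x) ->
  exists n, nbhs 1%g [set (xy.1 * xy.2^-1)%g | xy in A n `*` A n].
Proof.
move=> pG bA cA; have /all_sig2[U oU rU] := (fun n => cid2 (bA n)).
have [|x [_ rx]] := polish_residual_dense pG (residual_bigcap rU) _ openT.
  by exists 1%g.
have [n Anx] := cA x; have /= /(_ Anx) Unx := (rx n I).1.
exists n; have : nbhs 1%g [set g : G | U n (g * x)%g].
  by apply: (@mulgr_continuous G x); rewrite mul1g; exact: open_nbhs_nbhs.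
apply: filterS => g /= Ugx.
pose W := U n `&` [set y | U n (g^-1 * y)%g].
have oW : open W.
  by apply: openI => //; apply: open_comp => // y _; exact: mulgl_continuous.
have [|y [[Uy Ugy] [ry rgy]]] := polish_residual_dense pG
  (residualI (rU n) (residual_mulgl g^-1%g (rU n))) _ oW.
  by exists (g * x)%g; split => //=; rewrite mulKg.
exists (y, g^-1 * y)%g; first by split; [exact/ry|exact/rgy].
by rewrite /= invgM invgK mulVKg.
Qed.

(** * Length functions and the Birkhoff-Kakutani construction *)

Section left_invariant_pseudometric_of_length.
Variables (R : realType) (G : topologicalGroupType) (N : G -> R).
Hypotheses (N1 : N 1%g = 0) (NM : forall x y, N (x * y)%g <= N x + N y)
  (NV : forall x, N (x^-1)%g = N x)
  (cN : forall e, 0 < e -> nbhs 1%g [set x | N x < e]).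

Lemma length_left_invariant_pseudometric :
  continuous_left_invariant_pseudometric R G (fun x y => N (x^-1 * y)%g).
Proof.
have pN : pseudometric (fun x y => N (x^-1 * y)%g).
  split=> [x|x y|x y z]; first by rewrite mulVg.
    by rewrite -NV invgM invgK.
  have -> : (x^-1 * z = (x^-1 * y) * (y^-1 * z))%g by rewrite mulgA mulgK.
  exact: NM.
split=> // [g x y|[x y]].
  by rewrite invgM -mulgA mulKg.
have [_ dC dD] := pN.
have near_x (z : G) e : 0 < e -> \forall w \near z, N (z^-1 * w)%g < e.
  move=> e0; have := @mulgl_continuous G z^-1%g z.
  by rewrite /continuous_at mulVg => /(_ _ (cN e0)).
apply/cvgrPdist_lt => e e0.
exists ([set w | N (x^-1 * w)%g < e / 2], [set w | N (y^-1 * w)%g < e / 2]).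
  by split; apply: near_x; rewrite divr_gt0.
move=> [x' y'] /= [xx' yy'].
have := dD x x' y; have := dD x' y' y; have := dD x' x y'; have := dD x y y'.
rewrite (dC x' x) (dC y' y) ltr_norml => *.
by apply/andP; split; lra.
Qed.

End left_invariant_pseudometric_of_length.

(** A chain is a factorization of [g] in which a factor from [V k] costs [2 ^ k]; the infimum of the
    total costs will be the length of [g]. The number of factors is recorded for a strong
    induction. *)
Inductive weighted_chain (R : realType) (G : groupType) (V : int -> set G) :
    nat -> G -> R -> Prop :=
| weighted_chain_nil : weighted_chain V 0 1%g 0
| weighted_chain_cons n k x g c : V k x -> weighted_chain V n g c ->
    weighted_chain V n.+1 (x * g)%g (2 ^ k + c).

Section weighted_chains.
Variables (R : realType) (G : groupType) (V : int -> set G).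
Implicit Types (g : G) (c : R).

Lemma weighted_chain_ge0 n g c : weighted_chain V n g c -> 0 <= c.
Proof. by elim=> // {}n k x {}g {}c _ _ c0; rewrite addr_ge0// exprz_ge0. Qed.

Lemma weighted_chain_mul n m g h c e : weighted_chain V n g c ->
  weighted_chain V m h e -> weighted_chain V (n + m) (g * h)%g (c + e).
Proof.
move=> + hh; elim=> [|{}n k x {}g {}c Vx _ IH]; first by rewrite mul1g add0r.
by rewrite addSn -mulgA -addrA; exact: weighted_chain_cons.
Qed.

Lemma weighted_chain1 k x : V k x -> weighted_chain V 1 x (2 ^ k : R).
Proof.
move=> Vx; rewrite -[x]mulg1 -[2 ^ k]addr0.
by apply: weighted_chain_cons => //; exact: weighted_chain_nil.
Qed.

Lemma weighted_chain_inv n g c : (forall k x, V k x -> V k (x^-1)%g) ->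
  weighted_chain V n g c -> weighted_chain V n (g^-1)%g c.
Proof.
move=> VV; elim=> [|{}n k x {}g {}c /VV Vx _ IH].
  by rewrite invg1; exact: weighted_chain_nil.
rewrite invgM addrC -addn1; apply: weighted_chain_mul => //.
exact: weighted_chain1.
Qed.

(** The pivot [x] is the first factor after which the remaining cost is below [b]. If factors
    precede it, the cost from the pivot on is still at least [b], so they cost less than [a]. *)
Lemma weighted_chain_split n g c a b : weighted_chain V n g c ->
  (0 < n)%N -> 0 < a -> 0 < b -> c < a + b ->
  exists n1 g1 c1 k x n2 g2 c2, [/\ weighted_chain V n1 g1 c1 /\ c1 < a,
    V k x /\ 2 ^ k <= c, weighted_chain V n2 g2 c2 /\ c2 < b,
    (n1 < n)%N /\ (n2 < n)%N & g = (g1 * x * g2)%g].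
Proof.
move=> ch; elim: ch a => // {}n k x {}g {}c Vx ch IH a _ a0 b0 cab.
have c0 := weighted_chain_ge0 ch; have k0 : 0 < 2 ^ k :> R by exact: exprz_gt0.
have [cb|bc] := ltP c b.
  exists 0%N, 1%g, 0, k, x, n, g, c; split => //.
  - by split => //; exact: weighted_chain_nil.
  - by rewrite lerDl.
  - by rewrite mul1g.
have n0 : (0 < n)%N by case: ch bc => //; lra.
have a'0 : 0 < a - 2 ^ k by lra.
have a'b : c < a - 2 ^ k + b by lra.
have [n1 [g1 [c1 [j [y [n2 [g2 [c2 [H1 H2 H3 H4 ->]]]]]]]]] :=
  IH _ n0 a'0 b0 a'b.
move: H1 H2 H3 H4 => [ch1 c1a] [Vy jc] [ch2 c2b] [n1n n2n].
exists n1.+1, (x * g1)%g, (2 ^ k + c1), j, y, n2, g2, c2; split => //.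
- by split; [exact: weighted_chain_cons|lra].
- by split => //; lra.
- by split => //; exact: ltnW.
- by rewrite !mulgA.
Qed.

End weighted_chains.

Lemma natr_exp_unbounded (R : realType) (b : nat) (x : R) :
  (1 < b)%N -> exists n, x < b%:R ^+ n.
Proof.
move=> b1; exists (Num.truncn x).+1; apply: lt_le_trans (truncnS_gt x) _.
by rewrite -natrX ler_nat ltnW// ltn_expl.
Qed.

(* The two-sided form of the Birkhoff-Kakutani construction: small [k] give
   continuity, large [k] control the pseudometric at infinity. *)
Lemma birkhoff_kakutani (R : realType) (G : topologicalGroupType)
    (V : int -> set G) :
  (forall k, nbhs 1%g (V k)) ->
  (forall k x, V k x -> V k (x^-1)%g) ->
  (forall k x y z, V k x -> V k y -> V k z -> V (k + 1) (x * y * z)%g) ->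
  (forall x, exists k, V k x) ->
  exists2 d : G -> G -> R, continuous_left_invariant_pseudometric R G d &
    forall k x, d 1%g x < 2 ^ k -> V (k + 1) x.
Proof.
move=> V_nbhs VV VM V_cover.
have V1 k : V k 1%g by exact: nbhs_singleton.
have VS k x : V k x -> V (k + 1) x.
  by move=> Vx; have := VM _ _ _ _ Vx (V1 k) (V1 k); rewrite !mulg1.
have V_mono j k : j <= k -> V j `<=` V k.
  move=> jk; have [n ->] : exists n : nat, k = j + n%:Z.
    by exists `|k - j|%N; rewrite gez0_abs ?subr_ge0//; ring.
  elim: n => [|n IH]; first by rewrite addr0.
  by move=> x /IH/VS; rewrite -addrA -PoszD addn1.
(* A chain is split with [a = b = 2 ^ (k - 1)]. By induction both outer parts lie in [V k], and the
   pivot costs less than [2 ^ k], so it lies in [V k] too; the triple product condition [VM]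
   concludes. *)
have chainV n g k : (exists2 c : R, weighted_chain V n g c & c < 2 ^ k) ->
    V (k + 1) g.
  elim/ltn_ind: n g k => n IH g k [c ch ck].
  have [n0|n0] := posnP n.
    by move: ch; rewrite n0 => ch; inversion ch.
  have k1 : 2 ^ k = 2 ^ (k - 1) + 2 ^ (k - 1) :> R.
    by rewrite -[in LHS](subrK 1 k) expfzDr// expr1z mulrDr mulr1.
  have k0 : 0 < 2 ^ (k - 1) :> R by exact: exprz_gt0.
  rewrite k1 in ck.
  have [n1 [g1 [c1 [j [y [n2 [g2 [c2 [H1 H2 H3 H4 ->]]]]]]]]] :=
    weighted_chain_split ch n0 k0 k0 ck.
  move: H1 H2 H3 H4 => [ch1 c1a] [Vy jc] [ch2 c2b] [n1n n2n].
  have jk : j < k.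
    by rewrite -(@ltr_eXz2l R 2) ?ltr1n// k1; exact: le_lt_trans ck.
  have Vg1 : V k g1 by rewrite -[k](subrK 1); apply: (IH n1) => //; exists c1.
  have Vg2 : V k g2 by rewrite -[k](subrK 1); apply: (IH n2) => //; exists c2.
  by apply: VM => //; apply: V_mono Vy; exact: ltW.
pose C g := [set c : R | exists n, weighted_chain V n g c].
have C0 g : C g !=set0.
  have [k Vg] := V_cover g; exists (2 ^ k), 1%N; exact: weighted_chain1.
have lbC g : lbound (C g) 0 by move=> c [n /weighted_chain_ge0].
pose N g := inf (C g).
have N_le n g c : weighted_chain V n g c -> N g <= c.
  by move=> ch; apply: ge_inf; [exists 0; exact: lbC|exists n].
have N_ge0 g : 0 <= N g by apply: lb_le_inf.
have N_lt g e : N g < e -> exists2 c, C g c & c < e.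
  by move=> Ne; apply: inf_lt.
have N1 : N 1%g = 0.
  by apply/eqP; rewrite eq_le N_ge0 andbT; apply: N_le (weighted_chain_nil _ _).
have NM x y : N (x * y)%g <= N x + N y.
  apply/ler_addgt0Pr => e e0.
  have [|c [n chx] cx] := N_lt x (N x + e / 2); first by lra.
  have [|c' [m chy] cy] := N_lt y (N y + e / 2); first by lra.
  by have := N_le _ _ _ (weighted_chain_mul chx chy); lra.
have NV_le x : N (x^-1)%g <= N x.
  by apply: lb_le_inf => // c [n /(weighted_chain_inv VV)]; exact: N_le.
have NV x : N (x^-1)%g = N x.
  by apply/eqP; rewrite eq_le NV_le -{1}[x]invgK NV_le.
have NVk k x : V k x -> N x <= 2 ^ k.
  by move=> /(weighted_chain1 R); exact: N_le.
exists (fun x y => N (x^-1 * y)%g).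
  apply: length_left_invariant_pseudometric => // e e0.
  have [n _ /(_ n (leqnn n)) /= ne] := near_infty_natSinv_expn_lt (PosNum e0).
  apply: filterS (V_nbhs (- n.+1%:Z)) => x /NVk xn; apply: le_lt_trans xn _.
  apply: le_lt_trans ne; rewrite -exprnN div1r lef_pV2 ?posrE ?exprn_gt0//.
  by rewrite ler_weXn2l// ler1n.
move=> k x; rewrite invg1 mul1g => /N_lt[c [n ch] ck].
by apply: (chainV n); exists c.
Qed.

(** * Bounded sets and quasilengths *)

Lemma dist_coarseP (R : realType) (X : Type) (d : X -> X -> R)
    (A : set (X * X)) :
  dist_coarse (fun x y => (d x y)%:E) A <->
  exists M, forall x y, A (x, y) -> d x y <= M.
Proof.
split=> [supA|[M AM]]; last first.
  apply: (@le_lt_trans _ _ M%:E); last exact: ltry.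
  by apply: ge_ereal_sup => _ [[x y] /AM dM <-]; rewrite lee_fin.
have [->|/set0P[[x0 y0] A0]] := eqVneq A set0; first by exists 0.
have ub x y : A (x, y) ->
    ((d x y)%:E <= ereal_sup [set (d xy.1 xy.2)%:E | xy in A])%E.
  by move=> Axy; apply: ereal_sup_ubound; exists (x, y).
have := ub _ _ A0; move: supA ub; rewrite /dist_coarse /=.
case: (ereal_sup _) => // M _ ub _; exists M => x y /ub.
by rewrite lee_fin.
Qed.

Lemma left_coarse_boundedP (R : realType) (G : topologicalGroupType)
    (A : set G) :
  coarse_bounded (left_coarse R G) A <->
  forall d, continuous_left_invariant_pseudometric R G d ->
    exists M, forall x, A x -> d 1%g x <= M.
Proof.
split=> [bA d cd|bA d cd].
  have [->|/set0P[a Aa]] := eqVneq A set0; first by exists 0.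
  have /dist_coarseP[M AM] := bA d cd; have [[d0 dC dD] _ _] := cd.
  exists (d 1%g a + M) => x Ax.
  by have := AM a x (conj Aa Ax); have := dD 1%g a x; lra.
have [M AM] := bA d cd; have [[d0 dC dD] _ _] := cd.
apply/dist_coarseP; exists (M + M) => x y [/= /AM xM /AM yM].
by have := dD x 1%g y; rewrite (dC x 1%g); lra.
Qed.

Definition quasilength (R : realType) (G : groupType) (l : G -> R) (C : R) :=
  (forall x y, l (x * y)%g <= l x + l y + C) /\
  (forall x, l (x^-1)%g <= l x + C).

(** Sublevel sets of a corrected length [m], continued downwards by small neighbourhoods of [1],
    feed [birkhoff_kakutani]. The resulting pseudometric is bounded on [A], which places [A] in one
    sublevel set. *)
Lemma quasilength_bounded (R : realType) (G : topologicalGroupType)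
    (l : G -> R) (C K : R) (A : set G) :
  quasilength l C -> nbhs 1%g [set x | l x <= K] ->
  coarse_bounded (left_coarse R G) A -> exists M, forall x, A x -> l x <= M.
Proof.
move=> [lM lV] nK /left_coarse_boundedP bA.
(* The maximum gives exact symmetry; one added [C] per factor absorbs the error in the product
   inequality. *)
pose m x := Num.max (l x) (l (x^-1)%g) + C.
have lm x : l x + C <= m x by rewrite lerD2r le_max lexx.
have mV x : m (x^-1)%g = m x by rewrite /m invgK maxC.
have lVm x : l (x^-1)%g + C <= m x by rewrite -mV; exact: lm.
have mM x y : m (x * y)%g <= m x + m y.
  rewrite {1}/m -lerBrDr ge_max invgM.
  have := lM x y; have := lM y^-1%g x^-1%g.
  have := lm x; have := lm y; have := lVm x; have := lVm y => *.
  by apply/andP; split; lra.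
have m0 x : 0 <= m x.
  have := mM x (x^-1)%g; have := mM 1%g x.
  by rewrite mul1g mulgV mV; lra.
have mK x : l x <= K -> m x <= K + C + C.
  move=> xK; rewrite /m lerD2r ge_max.
  by have := lV x; have := lV x^-1%g; rewrite invgK => *; apply/andP; split; lra.
(* [K + C + C] bounds [m] wherever [l] is at most [K]; the extra [1] makes [L] positive. *)
pose L := K + C + C + 1; pose U := [set x | m x <= L].
have nU : nbhs 1%g U.
  by apply: filterS nK => x /= /mK; rewrite /U /L /=; lra.
have L0 : 0 < L.
  by have := mK _ (nbhs_singleton nK); have := m0 1%g; rewrite /L; lra.
pose P (W : set G) := nbhs 1%g W /\ forall x, W x -> W (x^-1)%g.
pose Q (_ : nat) (W W' : set G) :=
  forall x y z, W' x -> W' y -> W' z -> W (x * y * z)%g.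
have PU : P U by split => // x; rewrite /U /= mV.
have step n W : P W -> exists2 W', P W' & Q n W W'.
  move=> [nW _]; have half (D : set G) : nbhs 1%g D -> exists2 B : set G,
      nbhs 1%g B & forall x y, B x -> B y -> D (x * y)%g.
    rewrite -{1}(mulg1 1%g) => /(mulg_continuous (1%g, 1%g))[[B B']] /=.
    move=> [nB nB'] BD.
    exists (B `&` B'); first exact: filterI.
    by move=> x y [Bx _] [_ By]; exact: (BD (x, y)).
  have [W1 nW1 W1W] := half _ nW; have [W2 nW2 W2W1] := half _ nW1.
  have W12 x : W2 x -> W1 x.
    by move=> W2x; rewrite -[x]mulg1; apply: W2W1 => //; exact: nbhs_singleton.
  have nV2 : nbhs 1%g [set x | W2 (x^-1)%g].
    by apply: (@invg_continuous G 1%g); rewrite invg1.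
  exists (W2 `&` [set x | W2 (x^-1)%g]).
    split; first exact: filterI.
    by move=> x [W2x W2x']; split => //=; rewrite invgK.
  by move=> x y z [xW _] [yW _] [zW _]; apply: W1W; [exact: W2W1|exact: W12].
have [W [W0 WP WQ]] := invariant_dependent_choice PU step.
(* The ratio [3] matches the triple products, as [m] is subadditive. [Negz n] stands for [-(n + 1)],
   hence the index [n.+1]; the two halves meet because [W 0] is [U], the sublevel set for
   [k = 0]. *)
pose V k := match k with
  | Posz n => [set x | m x <= 3 ^+ n * L] | Negz n => W n.+1 end.
have [d cd dV] : exists2 d : G -> G -> R,
    continuous_left_invariant_pseudometric R G d &
    forall k x, d 1%g x < 2 ^ k -> V (k + 1) x.
  apply: birkhoff_kakutani.
  - move=> [n|n] /=; last by case: (WP n.+1).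
    apply: filterS nU => x; rewrite /U /= => /le_trans; apply.
    by rewrite ler_peMl ?(ltW L0)// exprn_ege1// ler1n.
  - by move=> [n|n] x /=; [rewrite mV|case: (WP n.+1) => _; exact].
  - move=> [n|[|n]] x y z.
    + rewrite -PoszD addn1 /= exprS => xn yn zn.
      by have := mM (x * y)%g z; have := mM x y; lra.
    + by rewrite /= => xW yW zW; have := WQ 0%N x y z xW yW zW; rewrite W0 mul1r.
    + have -> : Negz n.+1 + 1 = Negz n.
        by rewrite !NegzE -[n.+2]addn1 PoszD opprD subrK.
      exact: WQ.
  - move=> x; have [n xn] := @natr_exp_unbounded R 3 (m x / L) isT.
    by exists n; rewrite /= -ler_pdivrMr// ltW.
have [M AM] := bA d cd; have [k Mk] := @natr_exp_unbounded R 2 M isT.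
(* The exponent is [k.+1] because [dV] places the ball of radius [2 ^ k] in [V (k + 1)]. *)
exists (3 ^+ k.+1 * L) => x Ax.
have := dV k x (le_lt_trans (AM x Ax) Mk); rewrite -PoszD addn1 /=.
apply: le_trans; apply: le_trans (lm x); rewrite lerDl.
(* Inverting twice shows that [C] is nonnegative. *)
by have := lV x; have := lV x^-1%g; rewrite invgK; lra.
Qed.

(** * Borel measurability of the section, and its quasilengths *)

Lemma borel_preimage (X Y : topologicalType) (f : X -> Y) :
  (forall U : set Y, open U -> <<s open >> (f @^-1` U)) -> borel_measurable f.
Proof.
move=> fo; apply: smallest_sub => //; split => /=.
- by rewrite preimage_set0; exact: sigma_algebra0.
- by move=> B fB; rewrite setTD preimage_setC; exact: borelC.
- by move=> B fB; rewrite preimage_bigcup; exact: sigma_algebra_bigcup.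
Qed.

(** If [a * b^-1] avoids the closed set [H], so does [u * v^-1] for [u] near [a] and [v] near [b],
    and the open map [pi] carries these neighbourhoods to disjoint ones. *)
Lemma quotient_hausdorff (G : topologicalGroupType) (H : normal_subgroup G) :
  closed (H : set G) -> hausdorff_space (quotient_topgroup H).
Proof.
move=> cH x y; rewrite -(quotient_map_repr x) -(quotient_map_repr y).
move: (repr x) (repr y) => a b clab; apply/quotient_mapP; apply: contrapT => nab.
have nH : nbhs (a * b^-1)%g (~` (H : set G)).
  by apply: open_nbhs_nbhs; split => //; exact: closed_openC.
have [[U V'] /= [nU nV'] UV] := @mulg_continuous G (a, b^-1)%g _ nH.
have nV : nbhs b [set v | V' (v^-1)%g] by exact: (@invg_continuous G b _ nV').
have [_ [[u Uu <-] [v Vv /esym/quotient_mapP]]] :=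
  clab _ _ (quotient_map_nbhs H nU) (quotient_map_nbhs H nV).
exact: (UV (u, v^-1)%g).
Qed.

Section transversal_section.
Variables (R : realType) (G : topologicalGroupType) (H : normal_subgroup G).
Variables (T : set G).
Hypothesis transversalT : coset_transversal H T.
Local Notation pi := (quotient_map H).
Local Notation phi := (section_of H T).

Lemma section_of_mem x : T (phi x).
Proof.
have [t [tP _]] := transversalT x.
by have [] := xgetPex 1%g (ex_intro (fun t => T t /\ pi t = x) t tP).
Qed.

Lemma section_ofK x : pi (phi x) = x.
Proof.
have [t [tP _]] := transversalT x.
by have [] := xgetPex 1%g (ex_intro (fun t => T t /\ pi t = x) t tP).
Qed.

Lemma section_of_pi t : T t -> phi (pi t) = t.
Proof.
move=> Tt; have [u [_ uP]] := transversalT (pi t).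
rewrite -[RHS](uP t)//; apply/esym/uP.
by split; [exact: section_of_mem|exact: section_ofK].
Qed.

Lemma section_of_borel :
  closed (H : set G) -> analytic R T -> borel_measurable phi.
Proof.
move=> cH [T0|[P [f [pP cf fT]]]].
  by have := section_of_mem 1%g; rewrite T0.
have Tf p : T (f p) by rewrite -fT; exists p.
pose q := pi \o f.
have cq : continuous q.
  by move=> p; apply: continuous_comp; [exact: cf|exact: quotient_map_continuous].
have phiq p : phi (q p) = f p by exact: section_of_pi.
apply: borel_preimage => U oU; have [_ [d md _]] := pP.
have oV : open (f @^-1` U) by apply: open_comp => // p _; exact: cf.
have cV : closed (~` (f @^-1` U)) by exact: open_closedC.
have [F cF UF] := metrizes_open_Fsigma md oV.
have FU n p : F n p -> U (f p).
  by move=> Fp; have : (f @^-1` U) p by rewrite UF; exists n.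
(* [lusin_separation] takes images of closed sets, so the open preimage of [U] enters through its
   closed pieces [F n]. The second union is constant in its index and only fits the shape of
   [borel_separated_bigcup]. *)
have [C bC [FC UC]] : borel_separated (\bigcup_n (q @` F n))
    (\bigcup_(n : nat) (q @` ~` (f @^-1` U))).
  apply: borel_separated_bigcup => n _.
  apply: (lusin_separation pP (quotient_hausdorff cH) cq (cF n) cV).
  move=> p p' /FU Ufp nUfp' qq; apply: nUfp'.
  by rewrite /= -phiq -qq phiq.
(* The two separated images cover the quotient, which forces the separating set to be the preimage
   itself. *)
suff -> : phi @^-1` U = C by [].
apply/seteqP; split => x; have [p _ fp] : range f (phi x) by
    rewrite fT; exact: section_of_mem.
  move=> /= Ux; apply: FC; have : (f @^-1` U) p by rewrite /= fp.
  rewrite UF => -[n _ Fp]; exists n => //; exists p => //.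
  by rewrite /q /= fp section_ofK.
move=> Cx; apply: contrapT => /= nU; apply: (UC x) => //.
exists 0%N => //; exists p; first by rewrite /= fp.
by rewrite /q /= fp section_ofK.
Qed.

Lemma section_of_quasilength (d : G -> G -> R) :
  continuous_left_invariant_pseudometric R G d ->
  coarse_bounded (left_coarse R G) (inv2_mul T `&` H) ->
  exists C, quasilength (fun x => d 1%g (phi x)) C.
Proof.
move=> cd /left_coarse_boundedP/(_ d cd)[C bC].
have [[d0 dC dD] dl _] := cd.
have dV g : d 1%g (g^-1)%g = d 1%g g by rewrite -(dl g) mulg1 mulgV dC.
have dM g h : d 1%g (g * h)%g <= d 1%g g + d 1%g h.
  by rewrite -[in X in _ + X](dl g) mulg1.
(* This defect of multiplicativity has the form [s^-1 * t^-1 * u] with entries in [T], and [pi]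
   sends it to [1]. *)
have dH x y : d 1%g ((phi y)^-1 * (phi x)^-1 * phi (x * y))%g <= C.
  apply: bC; split.
    by exists (phi y), (phi x), (phi (x * y)%g); split=> //; exact: section_of_mem.
  rewrite -[(_ * _)%g]mulg1 -invg1; apply/quotient_mapP.
  rewrite !quotient_map_mul !quotient_map_inv !section_ofK.
  by rewrite -invgM mulVg.
(* Products need only [C]; the second term serves inverses, because [phi 1] may differ from [1]. *)
exists (C + d 1%g (phi 1%g)).
split=> [x y|x].
  have -> : phi (x * y)%g =
      (phi x * phi y * ((phi y)^-1 * (phi x)^-1 * phi (x * y)))%g.
    by rewrite -invgM mulVKg.
  have := dM (phi x * phi y)%g ((phi y)^-1 * (phi x)^-1 * phi (x * y))%g.
  have := dM (phi x) (phi y); have := dH x y.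
  have := pseudometric_ge0 1%g (phi 1%g) (let: And3 h _ _ := cd in h).
  lra.
have := dH x x^-1%g; rewrite mulgV; set h := (_ * _ * _)%g => hC.
have -> : phi (x^-1)%g = ((phi x)^-1 * (phi 1 * h^-1))%g.
  by rewrite /h invgM !mulgA mulgK invgM !invgK mulKg.
have := dM (phi x)^-1%g (phi 1%g * h^-1)%g; have := dM (phi 1%g) h^-1%g.
by rewrite !dV; lra.
Qed.

End transversal_section.

(** * Modesty of the section and comparison of the coarse structures *)

Lemma continuous_borel_measurable (X Y : topologicalType) (f : X -> Y) :
  continuous f -> borel_measurable f.
Proof.
move=> cf; apply: borel_preimage => U oU; apply: sub_sigma_algebra.
by apply: open_comp => // x _; exact: cf.
Qed.

Lemma closed_length_ball (R : realType) (G : topologicalGroupType)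
    (d : G -> G -> R) (r : R) :
  continuous_left_invariant_pseudometric R G d ->
  closed [set x | d 1%g x <= r].
Proof.
move=> [_ _ cd]; have cd1 : continuous (d 1%g : G -> R).
  move=> x; have c : {for x, continuous (fun x : G => (1%g, x) : G * G)}.
    by apply: cvg_pair; [exact: cvg_cst|exact: cvg_id].
  exact: (continuous_comp c (cd (1%g, x))).
by apply: (@preimage_closed _ _ (d 1%g) [set y | y <= r]) => //; exact: closed_le.
Qed.

Section quotient_coarse.
Variables (R : realType) (G : topologicalGroupType) (H : normal_subgroup G).
Local Notation pi := (quotient_map H).

Lemma section_of_modest (T : set G) : polish_space R G ->
  coset_transversal H T ->
  coarse_bounded (left_coarse R G) (inv2_mul T `&` H) ->
  borel_measurable (section_of H T) ->
  modest (left_coarse R (quotient_topgroup H)) (left_coarse R G)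
    (section_of H T).
Proof.
move=> pG tT bT mphi A bA; apply/left_coarse_boundedP => d cd.
pose l x := d 1%g (section_of H T x).
have [C lC] : exists C, quasilength l C := section_of_quasilength tT cd bT.
have [lM lV] := lC.
(* The sublevel sets are pulled back to [G], where Polishness is assumed; the neighbourhood found
   there is pushed down again by openness of [pi]. *)
pose B (n : nat) := [set g : G | l (pi g) <= n%:R].
have bB n : baire_property (B n).
  apply: borel_baire_property.
  apply: (continuous_borel_measurable (@quotient_map_continuous G H)
    (B := [set x | l x <= n%:R])).
  apply: (mphi [set g | d 1%g g <= n%:R]); rewrite -[X in _ X]setCK.
  apply: borelC; apply: sub_sigma_algebra; apply: closed_openC.
  exact: closed_length_ball.
have cB g : exists n, B n g.
  exists (Num.truncn (l (pi g))).+1; rewrite /B /= ltW//; exact: truncnS_gt.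
have [n nB] := pettis_cover pG bB cB.
(* One [C] pays for the inverse of [pi h] and one for the product. *)
have nK : nbhs 1%g [set x | l x <= n%:R + n%:R + C + C].
  apply: filterS (quotient_map_nbhs H nB) => _ [_ [[g h] [/= Bg Bh] <-] <-].
  rewrite /= quotient_map_mul quotient_map_inv.
  have := lM (pi g) (pi h)^-1%g; have := lV (pi h); move: Bg Bh.
  by rewrite /B /=; lra.
have [M AM] := quasilength_bounded lC nK bA.
by exists M => _ [x Ax <-]; exact: AM.
Qed.

Lemma quotient_pullback (d : quotient_topgroup H -> quotient_topgroup H -> R) :
  continuous_left_invariant_pseudometric R (quotient_topgroup H) d ->
  continuous_left_invariant_pseudometric R G (fun x y => d (pi x) (pi y)).
Proof.
move=> [[d0 dC dD] dl cd]; split=> [|g x y|[x y]]; first by split.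
  by rewrite !quotient_map_mul dl.
have c1 : {for (x, y), continuous (fun z : G * G => pi z.1)}.
  by apply: continuous_comp; [exact: cvg_fst|exact: quotient_map_continuous].
have c2 : {for (x, y), continuous (fun z : G * G => pi z.2)}.
  by apply: continuous_comp; [exact: cvg_snd|exact: quotient_map_continuous].
have c : {for (x, y), continuous (fun z : G * G => (pi z.1, pi z.2))}.
  exact: cvg_pair c1 c2.
exact: (continuous_comp c (cd (pi x, pi y))).
Qed.

Lemma left_coarse_sub_quotient (phi : quotient_topgroup H -> G) :
  (forall x, pi (phi x) = x) ->
  modest (left_coarse R (quotient_topgroup H)) (left_coarse R G) phi ->
  left_coarse R (quotient_topgroup H) `<=` quotient_coarse R H.
Proof.
move=> phiK mphi E cE.
pose A := [set (xy.1^-1 * xy.2)%g | xy in E].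
have /mphi/left_coarse_boundedP bA : coarse_bounded (left_coarse R _) A.
  apply/left_coarse_boundedP => d cd; have /dist_coarseP[M EM] := cE d cd.
  exists M => _ [[x y] Exy <-]; have [_ dl _] := cd.
  by rewrite -(dl x) mulg1 mulVKg; exact: EM.
pose E' : set (G * G) := [set xy | (phi @` A) (xy.1^-1 * xy.2)%g].
have cE' : left_coarse R G E'.
  move=> d cd; have [M AM] := bA d cd; have [_ dl _] := cd.
  apply/dist_coarseP; exists M => x y /AM.
  by rewrite -(dl x) mulg1 mulVKg.
have /coarse_sub := quotient_coarse_structure R H; apply;
  last exact: (quotient_coarse_controlled cE').
move=> [x y] Exy; have Axy : A (x^-1 * y)%g by exists (x, y).
exists (phi x, phi x * phi (x^-1 * y))%g.
  by exists (x^-1 * y)%g => //=; rewrite mulKg.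
by rewrite /= quotient_map_mul !phiK mulVKg.
Qed.

(* [pi] is controlled for the coarse structure of each Hausdorff pseudometric,
   because the Hausdorff distance of [pi g] and [pi f] is at most [d g f]. *)
Lemma quotient_coarse_sub_hausdorff :
  quotient_coarse R H `<=` hausdorff_coarse R H.
Proof.
move=> E cE d cd; have [[d0 dC dD] dl _] := cd.
have d_ge0 x y : 0 <= d x y by apply: pseudometric_ge0; case: cd.
(* A real-valued form of the Hausdorff distance, so that [dist_coarse_structure] applies to it. *)
pose D g f := inf [set d (h * g)%g f | h in H].
have lbD g f : lbound [set d (h * g)%g f | h in H] 0 by move=> _ [h _ <-].
have D_le g f h : (H : set G) h -> D g f <= d (h * g)%g f.
  by move=> Hh; apply: ge_inf; [exists 0; exact: lbD|exists h].
have D0 g f : [set d (h * g)%g f | h in H] !=set0.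
  by exists (d (1 * g)%g f), 1%g => //; exact: nsub1.
have D_lt g f e : 0 < e -> exists2 h, (H : set G) h & d (h * g)%g f < D g f + e.
  move=> e0; have [_ [h Hh <-] he] : exists2 c,
      [set d (h * g)%g f | h in H] c & c < D g f + e.
    by apply: inf_lt; [exact: D0|rewrite ltrDl].
  by exists h.
have DE g f : hausdorff_distance d (pi @^-1` [set pi g]) (pi @^-1` [set pi f])
    = (D g f)%:E.
  rewrite hausdorff_distance_coset// /D.
  rewrite -ereal_inf_EFin; [|by exists 0; exact: lbD|exact: D0].
  by congr ereal_inf; rewrite -image_comp.
pose dQ (x y : quotient_topgroup H) := D (repr x) (repr y).
have -> : (fun x y : quotient_topgroup H => hausdorff_distance d
    (pi @^-1` [set x]) (pi @^-1` [set y])) = (fun x y => (dQ x y)%:E).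
  apply/funext => x; apply/funext => y.
  by rewrite -{1}(quotient_map_repr x) -{1}(quotient_map_repr y) DE.
have dQ_pi g f : dQ (pi g) (pi f) = D g f.
  by apply: EFin_inj; rewrite -!DE !quotient_map_repr.
(* Near-optimal [h] for [(g, f)] and [k] for [(f, e)] combine to [k * h]: left invariance moves [k]
   past the first distance. *)
have DD g f e : D g e <= D g f + D f e.
  apply/ler_addgt0Pr => r r0; have r2 : 0 < r / 2 by rewrite divr_gt0.
  have [h Hh hr] := D_lt g f _ r2; have [k Hk kr] := D_lt f e _ r2.
  have := D_le g e _ (nsubM Hk Hh); have := dD (k * h * g)%g (k * f)%g e.
  by rewrite -mulgA dl; lra.
have DC g f : D f g <= D g f.
  apply/ler_addgt0Pr => r r0; have [h Hh hr] := D_lt g f _ r0.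
  apply: (le_trans (D_le f g _ (nsubV Hh))).
  by rewrite -(dl h) mulVKg dC ltW.
have pQ : pseudometric dQ.
  split=> [x|x y|x y z]; last exact: DD.
    apply/eqP; rewrite eq_le (lb_le_inf (D0 _ _) (lbD _ _)) andbT.
    by have := D_le (repr x) (repr x) _ (nsub1 H); rewrite mul1g d0.
  by apply/eqP; rewrite eq_le !DC.
apply: cE; split; first exact: dist_coarse_structure.
move=> A cA; have /dist_coarseP[M AM] := cA d cd.
apply/dist_coarseP; exists M => _ _ [[x y] Axy [<- <-]].
rewrite dQ_pi; apply: le_trans (AM _ _ Axy).
by rewrite -{2}[x]mul1g; apply: D_le; exact: nsub1.
Qed.

(** A pseudometric on the quotient pulls back to one on [G] that is constant on pairs of cosets, so
    its Hausdorff distance between fibres is the original distance. *)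
Lemma hausdorff_coarse_sub_left :
  hausdorff_coarse R H `<=` left_coarse R (quotient_topgroup H).
Proof.
move=> E cE d cd; have [[d0 dC dD] dl _] := cd.
have := cE _ (quotient_pullback cd); congr (dist_coarse _ E).
apply/funext => x; apply/funext => y.
rewrite -(quotient_map_repr x) -(quotient_map_repr y).
rewrite hausdorff_distance_coset; last exact: quotient_pullback.
set c := d _ _.
suff -> : [set (d (pi (h * repr x)%g) (pi (repr y)))%:E | h in H] = [set c%:E]
  by rewrite ereal_inf1.
have piH h : (H : set G) h -> pi (h * repr x)%g = pi (repr x).
  by move=> Hh; apply/quotient_mapP; rewrite mulgK.
apply/seteqP; split=> [_ [h Hh <-]|_ ->]; first by rewrite /= piH.
by exists 1%g; [exact: nsub1|rewrite mul1g].
Qed.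

End quotient_coarse.

Theorem theorem2 (R : realType) (G : topologicalGroupType)
    (H : normal_subgroup G) (T : set G)
    (polishG : polish_space R G)
    (closedH : closed (H : set G))
    (analyticT : analytic R T)
    (transversalT : coset_transversal H T)
    (boundedT : coarse_bounded (left_coarse R G) (inv2_mul T `&` H)) :
  [/\ borel_measurable (section_of H T),
      modest (left_coarse R (quotient_topgroup H)) (left_coarse R G)
        (section_of H T),
      quotient_coarse R H = left_coarse R (quotient_topgroup H) &
      left_coarse R (quotient_topgroup H) = hausdorff_coarse R H].
Proof.
have borel_phi := section_of_borel transversalT closedH analyticT.
have modest_phi := section_of_modest polishG transversalT boundedT borel_phi.
have LQ := left_coarse_sub_quotient (section_ofK transversalT) modest_phi.
have QHaus := @quotient_coarse_sub_hausdorff R G H.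
have HausL := @hausdorff_coarse_sub_left R G H.
split=> //; apply/seteqP; split => //.
- exact: subset_trans HausL.
- exact: subset_trans QHaus.
Qed.
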